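(* Let $H$ be a bipartite graph whose two vertex classes each have size $n$, where $n$ is even. Let $\mathcal{M}=\{M_1,\ldots,M_m\}$ be a partition of the edge set of $H$ into perfect matchings. Then the graph $G[\mathcal{M}]$ is bipartite.
   Context: For a partition $\mathcal{M}=\{M_1,\ldots,M_m\}$ of the edges of a graph $H$ into perfect matchings (1-factors), $G[\mathcal{M}]$ denotes the graph with vertex set $\{M_1,\ldots,M_m\}$ in which $M_i$ and $M_j$ ($i\neq j$) are adjacent if and only if $M_i\cup M_j$ is a Hamilton cycle of $H$. *)

(* Defs.v *)
From mathcomp Require Import all_boot.

Set Implicit Arguments.
Unset Strict Implicit.
Unset Printing Implicit Defensive.

Record sgraph (T : finType) := SGraph {
  adj :> rel T;
  adj_sym : symmetric adj;
  adj_irr : irreflexive adj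
}.

(* Edges are unordered pairs, represented as two-element vertex sets. *)
Definition edges (T : finType) (G : sgraph T) : {set {set T}} :=
  [set [set x; y] | x in T, y in T & G x y].

(* A class may be empty, so edgeless graphs are bipartite. *)
Definition bipartition (T : finType) (G : sgraph T) (A B : {set T}) : Prop :=
  [/\ A :|: B = [set: T],
      [disjoint A & B] &
      forall x y, G x y ->
        (x \in A) && (y \in B) || (x \in B) && (y \in A)].

Definition bipartite (T : finType) (G : sgraph T) : Prop :=
  exists A B : {set T}, bipartition G A B.

Definition perfect_matching (T : finType) (G : sgraph T)
    (M : {set {set T}}) : bool :=
  (M \subset edges G) && [forall v : T, #|[set f in M | v \in f]| == 1].

(* A Hamilton cycle is identified with its edge set.  A duplicate-free
   sequence c of length #|T| visits every vertex, and [next c] is the cyclic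
   successor.  The bound on #|T| excludes closed walks of length at most 2,
   which [cycle] would accept. *)
Definition hamilton_cycle (T : finType) (G : sgraph T)
    (F : {set {set T}}) : bool :=
  (2 < #|T|) &&
  [exists c : #|T|.-tuple T,
     [&& cycle G c, uniq c & F == [set [set x; next c x] | x in T]]].

Section MatchingGraph.

Variables (T : finType) (G : sgraph T) (P : {set {set {set T}}}).

Definition matching_adj : rel {M : {set {set T}} | M \in P} :=
  fun M N => (M != N) && hamilton_cycle G (val M :|: val N).

Lemma matching_adj_sym : symmetric matching_adj.
Proof. by move=> M N; rewrite /matching_adj eq_sym setUC. Qed.

Lemma matching_adj_irr : irreflexive matching_adj.
Proof. by move=> M; rewrite /matching_adj eqxx. Qed.

Definition matching_graph : sgraph {M : {set {set T}} | M \in P} :=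
  SGraph matching_adj_sym matching_adj_irr.

End MatchingGraph.

(* Main.v *)
(** A perfect matching [M] of [H] is a fixed-point free involution [s_M] that
    exchanges [A] and [B].  If the union of [M] and [N] is a Hamilton cycle, then
    the product of [s_M] and [s_N] permutes [A] as a single [n]-cycle, which is an
    odd permutation because [n] is even.  Fixing a matching [M0], the sign on [A]
    of the product of [s_M0] and [s_M] therefore differs for adjacent matchings
    [M] and [N], and so is a proper 2-colouring of [G[P]]. *)
Require Import Defs.
From mathcomp Require Import all_boot all_fingroup.

Set Implicit Arguments.
Unset Strict Implicit.
Unset Printing Implicit Defensive.

Section CyclicRestriction.

Local Open Scope group_scope.

Variables (T : finType) (A : {set T}).

(** The parity of [s] is that of [#|T|] plus its number of orbits, here [1 + #|~: A|]. *)
Lemma odd_perm_one_orbit (s : {perm T}) (x0 : T) :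
  x0 \in A -> porbit s x0 = A -> (forall x, x \notin A -> s x = x) ->
  odd_perm s = ~~ odd #|A|.
Proof.
move=> Ax0 orbA fixC.
have orb_fix x : x \notin A -> porbit s x = [set x].
  move=> nAx; apply/setP=> y; rewrite inE; apply/porbitP/eqP=> [[i ->]|->].
    by elim: i => [|i IHi]; rewrite ?expg0 ?perm1 // expgSr permM IHi fixC.
  by exists 0%N; rewrite expg0 perm1.
have defP : porbits s = A |: [set [set x] | x in ~: A].
  apply/setP=> X; rewrite !inE; apply/imsetP/orP=> [[x _ ->]|].
    have [Ax|nAx] := boolP (x \in A).
      by left; apply/eqP; rewrite -orbA; apply/eqP; rewrite eq_porbit_mem orbA.
    by right; rewrite orb_fix // imset_f // inE.
  case=> [/eqP->|/imsetP[x]]; first by exists x0.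
  by rewrite inE => nAx ->; exists x; rewrite ?orb_fix.
have nPA : A \notin [set [set x] | x in ~: A].
  by apply/imsetP=> [[x]]; rewrite inE => /negP nAx eA; apply: nAx; rewrite eA inE.
rewrite /odd_perm defP cardsU1 nPA card_imset; last exact: set1_inj.
by rewrite -(cardsC A) !oddD /=; do 2!case: odd.
Qed.

Definition swaps (s : {perm T}) :=
  involutive s /\ forall x, (s x \in A) = (x \notin A).

Lemma swaps_mul_norm s t : swaps s -> swaps t -> s * t \in 'N(A | 'P).
Proof.
move=> [_ sA] [_ tA]; apply/astabsP=> x.
by rewrite /= apermE permM tA sA negbK.
Qed.

(** [restr_perm A] is the identity off [A], so this is the sign on [A] alone. It is multiplicative
    only on the normaliser of [A], whence [swaps_mul_norm]. *)
Definition swap_sign (s t : {perm T}) : bool := odd_perm (restr_perm A (s * t)).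

(** Since [r], [s] and [t] are involutions, [s * t = (r * s)^-1 * (r * t)]. *)
Lemma swap_sign_comp r s t : swaps r -> swaps s -> swaps t ->
  swap_sign s t = swap_sign r s (+) swap_sign r t.
Proof.
move=> rS sS tS; rewrite /swap_sign -(odd_permV (restr_perm A (r * s))).
have rs_N := swaps_mul_norm rS sS; have rt_N := swaps_mul_norm rS tS.
rewrite -morphV // -odd_permM -morphM ?groupV //.
congr (odd_perm (restr_perm A _)).
have invS u : swaps u -> u^-1 = u.
  by case=> uK _; apply/permP=> x; apply: (perm_inj (s := u)); rewrite permKV uK.
by rewrite invMg !invS // mulgA -(mulgA s) -{1}(invS r) // mulVg mulg1.
Qed.

(** The hypothesis on [S] is the connectedness that a Hamilton cycle will supply. An orbit of
    [s * t] inside [A] and its image under [t], which lies outside [A], then cover everything, so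
    the orbit is [A]. *)
Lemma swap_sign_transitive s t x0 : x0 \in A -> swaps s -> swaps t ->
    (forall S : {set T}, x0 \in S -> (forall x, x \in S -> s x \in S) ->
       (forall x, x \in S -> t x \in S) -> S = setT) ->
  swap_sign s t = ~~ odd #|A|.
Proof.
move=> Ax0 sS tS connST; have stN := swaps_mul_norm sS tS.
have [[sK sA] [tK tA]] := (sS, tS).
set r := restr_perm A (s * t).
have rE x : x \in A -> r x = t (s x) by move=> Ax; rewrite restr_permE // permM.
apply: (odd_perm_one_orbit Ax0); last first.
  by move=> x; apply: out_perm; apply: restr_perm_on.
set O := porbit r x0.
have OA x : x \in O -> x \in A.
  case/porbitP=> i ->; elim: i => [|i IHi]; first by rewrite expg0 perm1.
  by rewrite expgSr permM rE // tA sA negbK.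
have Or x : (r x \in O) = (x \in O).
  by rewrite /O -!eq_porbit_mem; have := porbit_perm r 1 x; rewrite expg1 => ->.
(* The orbit [O] and its image under [t] together are stable under [s] and [t]. *)
have defT : O :|: t @^-1: O = setT.
  apply: connST => [|x|x]; rewrite !inE ?porbit_id //; last by rewrite tK orbC.
  case/orP=> [Ox|Otx]; apply/orP; first by right; rewrite -rE ?Or ?OA.
  (* Here [s x] lies in [A] and [r] sends it to [t x], which is in [O]. *)
  by left; rewrite -Or rE ?sK ?sA -?tA ?OA.
apply/setP=> x; apply/idP/idP=> [/OA //|Ax].
have := in_setT x; rewrite -defT !inE => /orP[//|/OA].
by rewrite tA Ax.
Qed.

End CyclicRestriction.

Section Partner.

Variables (T : finType) (G : sgraph T) (M : {set {set T}}).
Hypothesis hM : perfect_matching G M.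

(** The default [v] is never reached when [M] is a perfect matching. *)
Definition partner (v : T) : T := odflt v [pick w | [set v; w] \in M].

Lemma mem_edges x y : ([set x; y] \in edges G) = G x y.
Proof.
apply/imset2P/idP=> [[u v _]|Gxy]; last by exists x y; rewrite ?inE.
rewrite inE => /andP[_ Guv] exy.
have uv : u != v by apply: contraTneq Guv => ->; rewrite adj_irr.
have := set21 u v; have := set22 u v; have := set21 x y; have := set22 x y.
rewrite -exy {1 2}exy !inE.
move=> /orP[]/eqP ey /orP[]/eqP ex; move: uv Guv;
  rewrite ex ey ?(adj_sym _ v u) //.
  (* In the two cases left [x = y], which would force [u = v]. *)
  by rewrite !orbb => uv _ /eqP vu; rewrite vu eqxx in uv.
by rewrite !orbb => uv _ _ /eqP vu; rewrite vu eqxx in uv.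
Qed.

Lemma matching_adj_edge x y : [set x; y] \in M -> G x y.
Proof. by case/andP: hM => /subsetP sM _ /sM; rewrite mem_edges. Qed.

Lemma partner_edge v : [set v; partner v] \in M.
Proof.
rewrite /partner; case: pickP => [//|noM]; case/andP: hM => /subsetP sM /forallP.
move/(_ v)/cards1P=> [f ef]; have := set11 f; rewrite -ef inE => /andP[fM].
have /imset2P[x y _ _ fE] := sM f fM; move: fM; rewrite fE => fM.
by rewrite !inE => /orP[]/eqP ev; [have := noM y | have := noM x];
  rewrite ev 1?setUC ?fM // setUC fM.
Qed.

Lemma partner_unique v w : [set v; w] \in M -> w = partner v.
Proof.
move=> vwM; have vpM := partner_edge v.
case/andP: hM => _ /forallP/(_ v)/cards1P[f ef].
have fP g : g \in M -> v \in g -> g = f.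
  by move=> gM vg; apply/set1P; rewrite -ef inE gM.
have : w \in [set v; partner v].
  by rewrite (fP _ vpM) ?set21 // -(fP _ vwM) ?set21 ?set22.
rewrite !inE => /orP[]/eqP // wv.
by have := matching_adj_edge vwM; rewrite wv adj_irr.
Qed.

Lemma partnerK : involutive partner.
Proof. by move=> v; apply/esym/partner_unique; rewrite setUC partner_edge. Qed.

Definition partner_perm : {perm T} := perm (can_inj partnerK).

Lemma partner_perm_swaps A B : bipartition G A B -> swaps A partner_perm.
Proof.
case=> _ /pred0P dAB GAB; split=> x; rewrite !permE ?partnerK //.
have dis z : z \in A -> z \in B = false.
  by move=> Az; have := dAB z; rewrite /= Az.
case/orP: (GAB _ _ (matching_adj_edge (partner_edge x))) => /andP[].
  by move=> Ax Bp; rewrite Ax; apply: contraTF Bp => /dis->.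
by move=> Bx ->; apply/esym; apply: contraTN Bx => /dis->.
Qed.

End Partner.

(** Closure under the edges of [F] gives closure under [next c], whose iterates from [x0] reach
    every vertex. *)
Lemma hamilton_cycle_connected (T : finType) (G : sgraph T) F (S : {set T}) x0 :
    hamilton_cycle G F -> x0 \in S ->
    (forall x y, [set x; y] \in F -> x \in S -> y \in S) ->
  S = setT.
Proof.
case/andP=> _ /existsP[c /and3P[_ Uc /eqP defF]] Sx0 closedS.
have cT x : x \in c.
  have cardc : #|c| = #|T| by rewrite (card_uniqP Uc) size_tuple.
  by rewrite (subset_cardP cardc (subset_predT _)).
have Snext x : x \in S -> next c x \in S.
  by apply: closedS; rewrite defF; apply/imsetP; exists x.
apply/setP=> y; rewrite inE.
have /iter_findex <- : fconnect (next c) x0 y.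
  by rewrite (fconnect_cycle (cycle_next Uc)).
by elim: findex => //= i; apply: Snext.
Qed.

Theorem theorem1 (T : finType) (H : sgraph T) (A B : {set T}) (n : nat)
    (P : {set {set {set T}}})
    (hAB : bipartition H A B) (hA : #|A| = n) (hB : #|B| = n)
    (hn : ~~ odd n)
    (hP : partition P (edges H))
    (hPM : forall M, M \in P -> perfect_matching H M) :
  bipartite (matching_graph H P).
Proof.
pose s (M : {M | M \in P}) := partner_perm (hPM _ (valP M)).
have sS M : swaps A (s M) := partner_perm_swaps (hPM _ (valP M)) hAB.
have odd_adj M N : matching_graph H P M N -> swap_sign A (s M) (s N).
  case/andP=> _ ham; have [cardT _] := andP ham.
  (* With [n = 0] there would be no vertices, but a Hamilton cycle needs more than two. *)
  have [x0 Ax0] : exists x0, x0 \in A.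
    apply/set0Pn; rewrite -card_gt0 hA lt0n; apply: contraTneq cardT => n0.
    by case: hAB => AB _ _; rewrite -cardsT -AB cardsU hA hB n0.
  rewrite (swap_sign_transitive Ax0) ?hA // => S Sx0 SM SN.
  apply: (hamilton_cycle_connected ham Sx0) => x y.
  case/setUP=> [/(partner_unique (hPM _ (valP M))) -> /SM|
                /(partner_unique (hPM _ (valP N))) -> /SN]; by rewrite permE.
(* Without any matching to serve as [M0], the matching graph has no vertices. *)
have [M0 _|noM] := pickP (predT : pred {M | M \in P}); last first.
  exists setT, set0; split=> [|| M]; rewrite ?setU0 //; last by have := noM M.
  by rewrite -setI_eq0 setI0.
pose C := [set M | swap_sign A (s M0) (s M)].
exists C, (~: C); split; first exact: setUCr.
  by rewrite -setI_eq0 setICr.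
(* The signs of [M] and [N] relative to [M0] sum to 1, so exactly one of the two is in [C]. *)
move=> M N /odd_adj; rewrite (swap_sign_comp (sS M0)) // !inE.
by do 2!case: swap_sign.
Qed.
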